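(* Let $G$ be a connected $3$-regular graph. If $G$ has a unique longest cycle $\mathfrak{c}$, then at least two connected components of the graph $G - E(\mathfrak{c})$ (obtained from $G$ by deleting the edges of $\mathfrak{c}$ but keeping all vertices) contain an odd number of vertices of $\mathfrak{c}$. Moreover, there exist infinitely many connected $3$-regular graphs $G$ with a unique longest cycle $\mathfrak{c}$ such that exactly two connected components of $G - E(\mathfrak{c})$ contain an odd number of vertices of $\mathfrak{c}$.
   Context: Graphs are finite and simple. *)

(* Defs.v *)
From mathcomp Require Import all_boot.
Set Implicit Arguments.
Unset Strict Implicit.
Unset Printing Implicit Defensive.

Record sgraph := SGraph {
  vertex :> finType;
  adj : rel vertex;
  adj_sym : symmetric adj;
  adj_irr : irreflexive adj }.

Definition graph_iso (G H : sgraph) : Prop :=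
  exists f : G -> H, bijective f /\ forall x y, adj (f x) (f y) = adj x y.

Definition connected (G : sgraph) : Prop :=
  0 < #|G| /\ forall x y : G, connect (@adj G) x y.

Definition regular (k : nat) (G : sgraph) : Prop :=
  forall x : G, #|[set y | adj x y]| = k.

Definition components (G : sgraph) : {set {set G}} :=
  equivalence_partition (connect (@adj G)) [set: G].

Section DeleteEdges.
Variables (G : sgraph) (A : {set {set G}}).

(* An edge is encoded as the unordered pair [set x; y] of its endpoints. *)
Definition del_adj : rel G := [rel x y | adj x y && ([set x; y] \notin A)].

Lemma del_adj_sym : symmetric del_adj.
Proof. by move=> x y; rewrite /del_adj /= adj_sym setUC. Qed.

Lemma del_adj_irr : irreflexive del_adj.
Proof. by move=> x; rewrite /del_adj /= adj_irr. Qed.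

Definition del_edges : sgraph := SGraph del_adj_sym del_adj_irr.
End DeleteEdges.

Section Cycles.
Variable G : sgraph.

(* A cycle is given by a cyclic enumeration of its vertices; ucycle alone would
   also accept the empty sequence and a single edge traversed back and forth. *)
Definition is_cycle (c : seq G) : Prop := 2 < size c /\ ucycle (@adj G) c.

Definition cycle_edges (c : seq G) : {set {set G}} :=
  [set [set x; next c x] | x in c].

Definition longest_cycle (c : seq G) : Prop :=
  is_cycle c /\ forall d : seq G, is_cycle d -> size d <= size c.

(* Two enumerations describe the same cycle, as a subgraph, exactly when they
   have the same edge set (they then differ by rotation and reversal). *)
Definition unique_longest_cycle (c : seq G) : Prop :=
  longest_cycle c /\
  forall d : seq G, longest_cycle d -> cycle_edges d = cycle_edges c.

Definition odd_components (c : seq G) : {set {set G}} :=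
  [set K in components (del_edges (cycle_edges c)) |
    odd #|[set x in K | x \in c]|].
End Cycles.

(* Main.v *)
Require Import Defs.
From mathcomp Require Import all_boot.
Set Implicit Arguments.
Unset Strict Implicit.
Unset Printing Implicit Defensive.

(** Lower bound. Suppose at most one component of G - E(c) meets c in an odd
    number of vertices, and choose v0 on c, inside that component if there is
    one. A T-join of G - E(c) completes c to a subgraph in which a vertex other
    than v0 has odd degree exactly when it lies on c. There, a version of
    Thomason's lollipop argument applies: delete v0, fix a neighbor v1 of v0 on
    c, and consider the paths that end at v1 and cover the rest of c. They are
    linked by rotation at, extension of, and retraction of their free end, and
    the number of such moves from a path is odd exactly when its free end is a
    neighbor of v0. So the cycles through V(c) and the edge v0 v1 are even in
    number, and c is not the only one.

    Examples. Join by bridges, at its two vertices of degree 2, a hexagon with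
    two chords to cubic pieces all of whose cycles have length at most 5. A
    cycle cannot use a bridge, so the hexagon is the unique longest cycle; each
    chord puts two vertices of the hexagon in one component, so only the
    components of the two remaining vertices can be odd. *)

(** * Parity and T-joins *)

Lemma odd_card_set (T : finType) (P : pred T) :
  odd #|[set x | P x]| = \big[addb/false]_x P x.
Proof.
rewrite -sum1dep_card big_mkcond (big_morph odd oddD (erefl _)).
by apply: eq_bigr => x _; case: (P x).
Qed.

Lemma big_addb_pred1 (T : finType) (P : pred T) x :
  \big[addb/false]_y (P y && (y == x)) = P x.
Proof.
rewrite (bigD1 x) //= eqxx andbT big1 ?addbF // => y /negPf->.
exact: andbF.
Qed.

Lemma even_card_involution (T : finType) (f : T -> T) (A : {set T}) :
    {in A, forall x, [/\ f x \in A, f (f x) = x & f x != x]} ->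
  ~~ odd #|A|.
Proof.
move=> fA; pose g x := if x \in A then f x else x.
have gK : involutive g.
  move=> x; rewrite /g; case xA: (x \in A); rewrite ?xA //.
  by have [-> -> _] := fA x xA.
have g_order2 : A \subset order_set g 2.
  apply/subsetP=> x xA; have [_ _ fx] := fA x xA; rewrite inE.
  have gx : g x = f x by rewrite /g xA.
  have gcyc : fcycle g [:: x; f x] by rewrite /= gx eqxx -gx gK eqxx.
  by rewrite (order_cycle gcyc) ?mem_head //= inE eq_sym fx.
have closedA : fclosed g A.
  by move=> x _ /eqP<-; rewrite /g; case: ifP => [/fA[-> _ _]|->].
by rewrite -(fcard_order_set (inv_inj gK) g_order2 closedA) muln2 odd_double.
Qed.

Section Degree.
Variables (V : finType) (e : rel V).

Definition degree (x : V) : nat := #|[set y | e x y]|.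

Lemma odd_degree x : odd (degree x) = \big[addb/false]_y e x y.
Proof. exact: odd_card_set. Qed.
End Degree.

Lemma odd_degree_addb (V : finType) (e1 e2 : rel V) x :
  odd (degree [rel y z | e1 y z (+) e2 y z] x) =
  odd (degree e1 x) (+) odd (degree e2 x).
Proof. by rewrite !odd_degree big_split. Qed.

Section TJoins.
Variables (V : finType) (e : rel V).
Hypothesis e_sym : symmetric e.

Definition has_Tjoin (T : pred V) : Prop :=
  exists J : rel V,
    [/\ symmetric J, subrel J e & forall x, odd (degree J x) = T x].

Lemma eq_has_Tjoin (S T : pred V) : S =1 T -> has_Tjoin S -> has_Tjoin T.
Proof.
by move=> eqST [J [Jsym Je JS]]; exists J; split=> // x; rewrite -eqST.
Qed.

Lemma has_Tjoin0 : has_Tjoin pred0.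
Proof. by exists (fun _ _ => false); split=> // x; rewrite odd_degree big1. Qed.

Lemma has_Tjoin_addb (S T : pred V) :
  has_Tjoin S -> has_Tjoin T -> has_Tjoin (fun x => S x (+) T x).
Proof.
move=> [I [Isym Ie IS]] [J [Jsym Je JT]].
exists [rel x y | I x y (+) J x y]; split=> [x y|x y /=|x].
- by rewrite /= Isym Jsym.
- by case Jxy: (J x y); [rewrite (Je _ _ Jxy) | rewrite addbF => /Ie].
- by rewrite odd_degree_addb IS JT.
Qed.

Lemma has_Tjoin_edge x y : e x y -> has_Tjoin (fun z => (z == x) (+) (z == y)).
Proof.
move=> exy; exists [rel a b | (a == x) && (b == y) (+) (a == y) && (b == x)].
split=> [a b|a b /=|z].
- by rewrite /= addbC ![(b == _) && _]andbC.
- case: andP => [[/eqP-> /eqP->] //|_].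
  by case: andP => [[/eqP-> /eqP->]|//]; rewrite e_sym.
rewrite odd_degree big_split.
by rewrite (big_addb_pred1 (fun=> z == x)) (big_addb_pred1 (fun=> z == y)).
Qed.

Lemma has_Tjoin_connect x y :
  connect e x y -> has_Tjoin (fun z => (z == x) (+) (z == y)).
Proof.
case/connectP=> p; elim: p x => [|w p IHp] x /= => [_ ->|/andP[exw wp] yE].
  by apply: eq_has_Tjoin has_Tjoin0 => z /=; rewrite addbb.
apply: eq_has_Tjoin (has_Tjoin_addb (has_Tjoin_edge exw) (IHp w wp yE)) => z.
by rewrite addbA addbK.
Qed.

Lemma has_Tjoin_sum (I : Type) (s : seq I) (P : pred I) (T : I -> pred V) :
    (forall i, has_Tjoin (T i)) ->
  has_Tjoin (fun x => \big[addb/false]_(i <- s | P i) T i x).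
Proof.
move=> joinT; elim: s => [|i s IHs].
  by apply: eq_has_Tjoin has_Tjoin0 => x; rewrite big_nil.
case Pi: (P i); last by apply: eq_has_Tjoin IHs => x; rewrite big_cons Pi.
apply: eq_has_Tjoin (has_Tjoin_addb (joinT i) IHs) => x.
by rewrite big_cons Pi.
Qed.

(* Joining every vertex of T to the root of its component gives the right
   parities: a root is hit by as many paths as T has vertices around it. *)
Lemma has_Tjoin_even (T : {set V}) :
    (forall x, ~~ odd #|[set y | connect e x y & y \in T]|) -> has_Tjoin [in T].
Proof.
have e_csym := sym_connect_sym e_sym.
move=> evenT; pose to_root x z := (z == x) (+) (z == root e x).
have joins x : has_Tjoin (to_root x) by apply/has_Tjoin_connect/connect_root.
apply: eq_has_Tjoin (has_Tjoin_sum (index_enum V) [in T] joins) => z.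
have sum_self : \big[addb/false]_(x in T) (z == x) = (z \in T).
  rewrite -(big_addb_pred1 [in T] z) big_mkcond; apply: eq_bigr => x _.
  by rewrite eq_sym.
have sum_root : \big[addb/false]_(x in T) (z == root e x) = false.
  have [/eqP z_root|z_nonroot] := boolP (roots e z).
    apply: etrans (negbTE (evenT z)); rewrite odd_card_set big_mkcond.
    by apply: eq_bigr => y _; rewrite andbC -{1}z_root root_connect.
  apply: big1 => y _; apply: contraNF z_nonroot => /eqP->.
  exact: roots_root.
by rewrite big_split /= sum_self sum_root addbF.
Qed.

Lemma Tjoin_even_except (T : {set V}) x0 :
    (forall x, ~~ connect e x x0 ->
       ~~ odd #|[set y | connect e x y & y \in T]|) ->
  exists J : rel V, [/\ symmetric J, subrel J e &
    forall x, x != x0 -> odd (degree J x) = (x \in T)].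
Proof.
have e_csym := sym_connect_sym e_sym.
move=> evenT; pose b := odd #|[set y | connect e x0 y & y \in T]|.
pose T0 := [set y | (y \in T) (+) (b && (y == x0))].
have odd_T0 x : odd #|[set y | connect e x y & y \in T0]| =
    odd #|[set y | connect e x y & y \in T]| (+) (connect e x x0 && b).
  rewrite !odd_card_set -(big_addb_pred1 (fun y => connect e x y && b)).
  by rewrite -big_split; apply: eq_bigr => y _; rewrite inE andb_addr andbA.
have [x|J [Jsym Je JT0]] := @has_Tjoin_even T0.
  rewrite odd_T0; have [x_x0|/evenT/negPf->//] := boolP (connect e x x0).
  rewrite (_ : odd _ = b) ?addbb //; congr odd.
  by apply: eq_card => y; rewrite !inE (same_connect e_csym x_x0).
by exists J; split=> // x /negPf neq_x0; rewrite JT0 inE neq_x0 andbF addbF.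
Qed.
End TJoins.

(** * Lollipops *)

Lemma neq_nth_cat (T : eqType) (x0 z : T) i p s :
  z \notin p -> i < size p -> z != nth x0 (p ++ s) i.
Proof.
move=> z_p i_p; rewrite nth_cat i_p.
by apply: contraNneq z_p => ->; apply: mem_nth.
Qed.

Lemma rev_uniq_neq (T : eqType) (p : seq T) :
  uniq p -> 1 < size p -> rev p != p.
Proof.
case: p => [|x p] //; case/lastP: p => [|p y] // up _.
apply: contraTneq up; rewrite rev_cons rev_rcons => -[-> _].
by rewrite /= mem_rcons mem_head.
Qed.

Definition reverse_before (T : eqType) (z : T) (q : seq T) : seq T :=
  rev (take (index z q) q) ++ drop (index z q) q.

Lemma reverse_before_cat (T : eqType) (z : T) p s :
  z \notin p -> reverse_before z (p ++ z :: s) = rev p ++ z :: s.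
Proof.
move=> z_p; rewrite /reverse_before index_cat (negPf z_p) /= eqxx addn0.
by rewrite take_size_cat // drop_size_cat.
Qed.

Section Lollipop.
Variables (V : finType) (e : rel V) (r : V) (X : {set V}).
Hypotheses (e_sym : symmetric e) (e_irr : irreflexive e).
Hypothesis X_not_root : ~~ (X \subset [set r]).

(* A path is listed from its free end to its fixed end r. *)
Definition lollipop (q : seq V) : bool :=
  [&& uniq q, sorted e q, last r q == r & X \subset q].

(* A move (q, z) uses the edge from the free end of q to z. When this is the
   last edge of q, it retracts q, which must not uncover a vertex of X. *)
Definition legal_move (m : seq V * V) : bool :=
  let: (q, z) := m in
  [&& lollipop q, e (head r q) z & (z == nth r q 1) ==> (head r q \notin X)].

Definition make_move (m : seq V * V) : seq V * V :=
  let: (q, z) := m in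
  if z \notin q then (z :: q, head r q)
  else if z == nth r q 1 then (behead q, head r q)
  else (reverse_before z q, z).

Lemma lollipop_cons_cons q : lollipop q -> exists y w s, q = [:: y, w & s].
Proof.
case: q => [|y [|w s]] /and4P[_ _ /eqP/= rq Xq]; last by exists y, w, s.
all: case/negP: X_not_root; apply/subsetP=> x /(subsetP Xq).
all: by rewrite !inE ?rq.
Qed.

Lemma legal_extension q z :
  legal_move (q, z) -> z \notin q -> legal_move (z :: q, head r q).
Proof.
case/and3P=> /[dup] /lollipop_cons_cons[y [w [s ->]]].
case/and4P=> uq pq rq Xq eyz _ zq; apply/and3P; split; last 1 first.
- by apply/implyP=> _; apply: contra zq; apply: (subsetP Xq).
- apply/and4P; split=> //; first exact/andP.
    by rewrite /= e_sym eyz.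
  by apply: subset_trans Xq _; apply/subsetP=> x xq; rewrite inE xq orbT.
by rewrite e_sym.
Qed.

Lemma legal_retraction y w s :
  legal_move ([:: y, w & s], w) -> legal_move (w :: s, y).
Proof.
case/and3P=> /and4P[/= /andP[y_ws uws] /andP[eyw ps] rs Xq] _.
rewrite eqxx => yX; apply/and3P; split; last 1 first.
- apply/implyP=> /eqP yE; case/negP: y_ws; rewrite yE /=.
  by case: (s) rs => [/eqP<-|a t _]; rewrite !inE ?eqxx ?orbT.
- apply/and4P; split=> //; apply/subsetP=> x xX.
  have := subsetP Xq x xX; rewrite inE => /predU1P[xy|//].
  by rewrite -xy xX in yX.
by rewrite e_sym.
Qed.

Lemma legal_rotation p z s :
  1 < size p -> legal_move (p ++ z :: s, z) -> legal_move (rev p ++ z :: s, z).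
Proof.
case: p => [//|y p]; case/lastP: p => [//|p x] _.
case/and3P=> /and4P[uq pq rq Xq] /= eyz _.
set p0 := y :: rcons p x in uq pq rq Xq *.
have rev_p0 : rev p0 = x :: rcons (rev p) y by rewrite rev_cons rev_rcons.
have q_perm : perm_eq (rev p0 ++ z :: s) (p0 ++ z :: s).
  by rewrite perm_cat2r perm_rev.
have z_p0 : z \notin p0.
  by move: uq; rewrite uniq_catC /= mem_cat negb_or => /andP[/andP[]].
move: pq; rewrite sorted_cat_cons => /andP[sp ps].
have exz : e x z by move: sp; rewrite /= !rcons_path last_rcons => /andP[].
apply/and3P; split; last 1 first.
- have := @neq_nth_cat _ r z 1 (rev p0) (z :: s).
  by rewrite mem_rev size_rev /= size_rcons => /(_ z_p0 isT) /negPf->.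
- apply/and4P; split.
  + by rewrite (perm_uniq q_perm).
  + rewrite sorted_cat_cons ps andbT -rev_cons rev_sorted /= eyz.
    rewrite (eq_path (fun a b => e_sym b a)).
    by move: sp; rewrite /= rcons_path => /andP[].
  + by move: rq; rewrite !last_cat.
  + by apply: subset_trans Xq _; apply/subsetP=> v; rewrite (perm_mem q_perm).
by rewrite rev_p0.
Qed.

Lemma make_moveP m : legal_move m ->
  [/\ legal_move (make_move m), make_move (make_move m) = m & make_move m != m].
Proof.
case: m => q z Lm; have /and3P[Lq eyz _] := Lm; rewrite /make_move.
have [y [w [s qE]]] := lollipop_cons_cons Lq; have /and4P[uq _ _ _] := Lq.
have [zq|zq] := boolP (z \in q); last first.
  split; first exact: legal_extension.
    by rewrite qE /= !inE !eqxx orbT.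
  by apply/eqP=> -[/(congr1 size)/esym/n_Sn].
have [zw|neq_zw] := eqVneq z (nth r q 1).
  move: Lm uq; rewrite zw qE /= => Lm /andP[y_ws _]; split.
  - exact: legal_retraction.
  - by rewrite y_ws.
  - by apply/eqP=> -[wy _ _]; rewrite wy mem_head in y_ws.
case/splitPr: zq Lm uq qE eyz neq_zw {Lq} => p t Lm uq qE eyz neq_zw.
have z_p : z \notin p.
  by move: uq; rewrite uniq_catC /= mem_cat negb_or => /andP[/andP[]].
have p_gt1 : 1 < size p.
  case: (p) qE neq_zw eyz => [|a [|b p']] //=; last by rewrite eqxx.
  by case=> -> _ _; rewrite e_irr.
have rotL := legal_rotation p_gt1 Lm.
have z_revp : z \notin rev p by rewrite mem_rev.
rewrite reverse_before_cat //; split=> //=.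
  rewrite mem_cat mem_head orbT (negPf (neq_nth_cat _ _ z_revp _)) ?size_rev //.
  by rewrite reverse_before_cat // revK.
rewrite xpair_eqE eqxx andbT eqseq_cat ?size_rev // eqxx andbT.
by rewrite rev_uniq_neq //; move: uq; rewrite cat_uniq => /and3P[].
Qed.

Definition unbalanced (q : seq V) : bool :=
  odd (degree e (head r q)) (+) (head r q \in X).

Lemma odd_legal_moves q :
  lollipop q -> odd #|[set z | legal_move (q, z)]| = unbalanced q.
Proof.
move=> Lq; have [y [w [s qE]]] := lollipop_cons_cons Lq.
have eyw : e y w by move: Lq; rewrite qE => /and4P[_ /andP[]].
rewrite odd_card_set /unbalanced odd_degree qE /=.
rewrite -[in RHS](big_addb_pred1 (fun=> y \in X) w) -big_split -qE.
apply: eq_bigr => z _ /=; rewrite Lq.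
by case: eqVneq => [->|_]; rewrite ?eyw ?andbT ?andbF ?addbF.
Qed.

Lemma insub_bseq_lollipop q : lollipop q -> val (insub_bseq #|V| q) = q.
Proof.
case/and4P=> uq _ _ _; rewrite insubdK // -topredE /= -(card_uniqP uq).
exact: max_card.
Qed.

Lemma even_unbalanced_lollipops :
  ~~ odd #|[set q : #|V|.-bseq V | lollipop q && unbalanced q]|.
Proof.
pose to_move (m : #|V|.-bseq V * V) := (val m.1, m.2).
have to_move_inj : injective to_move by move=> [q z] [q' z'] [/val_inj-> ->].
pose moves := [set m | legal_move (to_move m)].
set A := [set _ | _]; have <- : odd #|moves| = odd #|A|.
  rewrite !odd_card_set.
  rewrite -(pair_big xpredT xpredT (fun q z => legal_move (val q, z))).
  apply: eq_bigr => q _; have [Lq|/negPf notLq] := boolP (lollipop q).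
    by rewrite -odd_legal_moves // odd_card_set.
  by rewrite big1 // => z _; rewrite /= notLq.
pose step m := let: (q, z) := make_move (to_move m) in (insub_bseq #|V| q, z).
have stepE m : m \in moves -> to_move (step m) = make_move (to_move m).
  rewrite inE => /make_moveP[]; rewrite /step; case: (make_move _) => q z.
  by case/and3P=> Lq _ _ _ _; rewrite /to_move /= insub_bseq_lollipop.
apply: (@even_card_involution _ step) => m m_moves.
have := m_moves; rewrite inE => /make_moveP[legal_step stepK step_neq].
have step_moves : step m \in moves by rewrite inE stepE.
split=> //; first by apply: to_move_inj; rewrite !stepE.
by rewrite -(inj_eq to_move_inj) stepE.
Qed.

Lemma second_unbalanced_lollipop q : lollipop q -> unbalanced q ->
  exists q', [/\ lollipop q', unbalanced q' & q' != q].
Proof.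
move=> Lq Uq; have := even_unbalanced_lollipops; set A := [set _ | _] => evenA.
pose b := insub_bseq #|V| q.
have bA : b \in A by rewrite inE insub_bseq_lollipop // Lq.
have [q' /[!inE]/and3P[neq_q' Lq' Uq']] : exists q', q' \in A :\ b.
  apply/set0Pn; rewrite -card_gt0; move: evenA; rewrite (cardsD1 b) bA.
  by case: #|_|.
exists q'; split=> //; apply: contra neq_q'.
by rewrite -val_eqE insub_bseq_lollipop.
Qed.
End Lollipop.

Lemma cycle_cons_sorted (T : Type) (e : rel T) x p : 0 < size p ->
  cycle e (x :: p) = [&& e x (head x p), sorted e p & e (last x p) x].
Proof. by case: p => //= y p _; rewrite rcons_path. Qed.

Section DeleteVertex.
Variables (V : finType) (e : rel V) (v0 : V).

Definition del_vertex : rel V := [rel x y | [&& e x y, x != v0 & y != v0]].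

Lemma odd_degree_del_vertex x :
  x != v0 -> odd (degree del_vertex x) = odd (degree e x) (+) e x v0.
Proof.
move=> x_v0; rewrite !odd_degree -(big_addb_pred1 (e x)) -big_split.
apply: eq_bigr => y _.
by rewrite /del_vertex /= x_v0; case: (e x y); case: (y == v0).
Qed.

Lemma sorted_del_vertex p :
  1 < size p -> sorted del_vertex p = sorted e p && (v0 \notin p).
Proof.
case: p => [|x [|y p]] // _; elim: p x y => [|z p IHp] x y.
  by rewrite /del_vertex /= !inE negb_or ![v0 == _]eq_sym !andbT.
rewrite -[LHS]/(del_vertex x y && sorted del_vertex [:: y, z & p]) IHp.
rewrite /del_vertex /= !inE !negb_or ![v0 == _]eq_sym.
by case: (x == v0) (y == v0) => [] []; rewrite /= ?andbF ?andbT ?andbA.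
Qed.
End DeleteVertex.

(* In the graph without v0, a path that ends at [last v0 q] and covers q is
   unbalanced exactly when it starts at a neighbor of v0. *)
Lemma second_cycle (V : finType) (e : rel V) (v0 : V) (q : seq V) :
    symmetric e -> irreflexive e -> 1 < size q -> ucycle e (v0 :: q) ->
    (forall x, x != v0 -> odd (degree e x) = (x \in q)) ->
  exists q', [/\ ucycle e (v0 :: q'), last v0 q' = last v0 q,
                 {subset q <= q'} & q' != q].
Proof.
move=> e_sym e_irr q_gt1 /andP[cq /andP[v0q uq]] e_odd.
pose f := del_vertex e v0; pose v1 := last v0 q; pose X := [set x in q].
have f_sym : symmetric f.
  by move=> x y; rewrite /f /del_vertex /= e_sym [_ && (x != _)]andbC.
have f_irr : irreflexive f by move=> x; rewrite /f /del_vertex /= e_irr.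
have X_v1 : ~~ (X \subset [set v1]).
  apply: contraL q_gt1 => /subset_leq_card; rewrite cards1 cardsE.
  by rewrite (card_uniqP uq) leqNgt.
have unbalancedE p : 0 < size p -> v0 \notin p ->
    unbalanced f v1 X p = e (head v0 p) v0.
  case: p => // y p _; rewrite inE negb_or eq_sym => /andP[y_v0 _].
  by rewrite /unbalanced inE -e_odd // odd_degree_del_vertex // addbC addKb.
have q_gt0 := ltnW q_gt1.
move: cq; rewrite cycle_cons_sorted // => /and3P[ev0 sq ev1].
have Lq : lollipop f v1 X q.
  apply/and4P; split=> //; first by rewrite sorted_del_vertex // sq.
    by rewrite /v1; case: (q) q_gt0.
  by apply/subsetP=> x; rewrite inE.
have Uq : unbalanced f v1 X q by rewrite unbalancedE // e_sym.
have [q' [Lq' Uq' neq_q']] := second_unbalanced_lollipop f_sym f_irr X_v1 Lq Uq.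
have [y [w [s q'E]]] := lollipop_cons_cons X_v1 Lq'.
have q'_gt1 : 1 < size q' by rewrite q'E.
case/and4P: Lq' => uq' /[!sorted_del_vertex]// /andP[sq' v0q'] lq' Xq'.
have last_q' : last v0 q' = last v0 q by move: lq'; rewrite q'E => /eqP.
exists q'; split=> //; last by move=> x xq; apply: (subsetP Xq'); rewrite inE.
have q'_gt0 := ltnW q'_gt1; rewrite unbalancedE // e_sym in Uq'.
by rewrite /ucycle cycle_cons_sorted //= Uq' sq' last_q' ev1 v0q'.
Qed.

(** * Two odd components *)

Definition cycle_adj (T : eqType) (c : seq T) (x y : T) : bool :=
  (x \in c) && ((y == next c x) || (y == prev c x)).

Lemma cycle_adj_map (S T : eqType) (f : S -> T) (c : seq S) x y :
  injective f -> uniq c -> cycle_adj (map f c) (f x) (f y) = cycle_adj c x y.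
Proof.
move=> f_inj uc; rewrite /cycle_adj mem_map // next_map // prev_map //.
by rewrite !(inj_eq f_inj).
Qed.

Lemma next_next_neq (T : eqType) (c : seq T) x :
  uniq c -> 2 < size c -> x \in c -> next c (next c x) != x.
Proof.
move=> uc c_gt2 xc; have [i s rotE] := rot_to xc.
rewrite -!(next_rot i uc) rotE; have: uniq (x :: s) by rewrite -rotE rot_uniq.
have: 2 < size (x :: s) by rewrite -rotE size_rot.
case: s {rotE} => [|a [|b t]] //= _; rewrite !inE !negb_or eqxx.
by case/and3P=> /and3P[xa xb _] _ _; rewrite (eq_sym a) (negPf xa) eqxx eq_sym.
Qed.

Lemma even_cycle_degree (T : finType) (c : seq T) x :
  uniq c -> 2 < size c -> ~~ odd (degree (cycle_adj c) x).
Proof.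
move=> uc c_gt2; have [xc|/negPf xc] := boolP (x \in c); last first.
  by rewrite odd_degree big1 // => y _; rewrite /cycle_adj xc.
rewrite /degree (_ : [set y | _] = [set next c x; prev c x]); last first.
  by apply/setP=> y; rewrite !inE /cycle_adj xc.
rewrite cards2 (_ : next c x != prev c x) //.
by apply: contra (next_next_neq uc c_gt2 xc) => /eqP->; rewrite next_prev.
Qed.

Lemma eq_cycle_adj_mem (T : eqType) (c d : seq T) :
  cycle_adj c =2 cycle_adj d -> c =i d.
Proof.
move=> adj_cd x; apply/idP/idP=> [xc|xd].
  by have:= adj_cd x (next c x); rewrite /cycle_adj xc eqxx => /esym/andP[].
by have:= adj_cd x (next d x); rewrite /cycle_adj xd eqxx => /andP[].
Qed.

Lemma exists_exit (T : eqType) (c : seq T) (P : pred T) x y :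
    uniq c -> x \in c -> y \in c -> P x -> ~~ P y ->
  exists z, [/\ z \in c, P z & ~~ P (next c z)].
Proof.
move=> uc xc yc Px notPy; pose stays := [rel a b | P a ==> P b].
have [|no_exit] := boolP (has [pred z | P z && ~~ P (next c z)] c).
  by case/hasP=> z zc /andP[]; exists z.
have stays_trans : transitive stays.
  by move=> b a d /=; case: (P a) (P b) => [] [].
have: cycle stays c.
  apply: cycle_from_next => // z zc.
  by have := hasPn no_exit z zc; rewrite /= negb_and negbK -implybE.
rewrite cycle_all2rel // => /allrelP/(_ x y xc yc) /=.
by rewrite Px (negPf notPy).
Qed.

Lemma eq_next (T : eqType) (c d : seq T) x :
    uniq c -> uniq d -> 2 < size d -> cycle_adj c =2 cycle_adj d ->
    x \in c -> next c x = next d x ->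
  {in c, next c =1 next d}.
Proof.
move=> uc ud d_gt2 adj_cd xc eq_x y yc; have mem_cd := eq_cycle_adj_mem adj_cd.
pose agree := [pred z | next c z == next d z].
apply/eqP; apply: contraT => neq_y; have agree_x : agree x by apply/eqP.
have [z [zc /eqP eq_z /eqP[]]] := exists_exit uc xc yc agree_x neq_y.
have: cycle_adj c (next c z) (next d (next c z)).
  by rewrite adj_cd /cycle_adj -mem_cd mem_next zc eqxx.
rewrite /cycle_adj mem_next zc prev_next // => /predU1P[->//|/eqP back].
by rewrite mem_cd in zc; case/eqP: (next_next_neq ud d_gt2 zc); rewrite -eq_z.
Qed.

Lemma set2_injr (T : finType) (x y z : T) : [set x; y] = [set x; z] -> y = z.
Proof.
move/setP=> eq_xyz; have := eq_xyz y; have := eq_xyz z.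
rewrite !inE !eqxx !orbT.
by case/predU1P=> [->|/eqP//] /esym/predU1P[|/eqP].
Qed.

Lemma cycle_adj_rot (T : eqType) n (c : seq T) :
  uniq c -> cycle_adj (rot n c) =2 cycle_adj c.
Proof. by move=> uc x y; rewrite /cycle_adj mem_rot next_rot ?prev_rot. Qed.

Lemma next_last (T : eqType) (x : T) p :
  uniq (x :: p) -> next (x :: p) (last x p) = x.
Proof. by move=> up; rewrite next_nth mem_last index_last // nth_default. Qed.

Lemma cycle_adj_inj (T : finType) (x : T) p q :
    uniq (x :: p) -> uniq (x :: q) -> 1 < size q -> last x p = last x q ->
  cycle_adj (x :: p) =2 cycle_adj (x :: q) -> p = q.
Proof.
move=> up uq q_gt1 last_pq adj_pq.
have next_pq : {in x :: p, next (x :: p) =1 next (x :: q)}.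
  apply: (eq_next up uq q_gt1 adj_pq (mem_last x p)).
  by rewrite next_last // last_pq next_last.
have fp : fcycle (next (x :: p)) (x :: p) by apply: cycle_next.
have fq : fcycle (next (x :: p)) (x :: q).
  apply: cycle_from_next => // y yq; apply/eqP/next_pq.
  by rewrite (eq_cycle_adj_mem adj_pq).
suff [] : x :: p = x :: q by [].
have := orbitE fp up (mem_head x p).
have := orbitE fq uq (mem_head x q).
by rewrite /= eqxx !rot0 => -> ->.
Qed.

Section CycleEdges.
Variable G : sgraph.
Implicit Types (c d : seq G) (x y : G).

Lemma mem_cycle_edges c x y :
  uniq c -> ([set x; y] \in cycle_edges c) = cycle_adj c x y.
Proof.
move=> uc; apply/imsetP/andP => [[z zc xyE]|[xc /orP[]/eqP->]]; first last.
- by exists (prev c x); rewrite ?mem_prev // next_prev // setUC.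
- by exists x.
have := set21 x y; rewrite xyE => /set2P[xE|xE]; rewrite xE in xyE *.
  by rewrite (set2_injr xyE) zc eqxx.
rewrite [RHS]setUC in xyE.
by rewrite (set2_injr xyE) mem_next prev_next // zc eqxx orbT.
Qed.

Lemma eq_cycle_edges c d : uniq c -> uniq d ->
  cycle_edges c = cycle_edges d <-> cycle_adj c =2 cycle_adj d.
Proof.
move=> uc ud; split=> [eq_cd x y|adj_cd].
  by rewrite -!mem_cycle_edges // eq_cd.
apply/setP=> A; apply/idP/idP=> /[dup] /imsetP[x _ ->].
  by rewrite !mem_cycle_edges // adj_cd.
by rewrite !mem_cycle_edges // adj_cd.
Qed.
End CycleEdges.

Lemma connect_equivalence (G : sgraph) : equivalence_rel (connect (@adj G)).
Proof.
move=> x y z; split=> [|xy]; first exact: connect0.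
exact: same_connect (sym_connect_sym (@adj_sym G)) _ _ xy z.
Qed.

Lemma components_partition (G : sgraph) : partition (components G) [set: G].
Proof.
by apply: equivalence_partitionP => x y z _ _ _; apply: connect_equivalence.
Qed.

Lemma mem_component (G : sgraph) (x y : G) :
  (y \in pblock (components G) x) = connect (@adj G) x y.
Proof.
rewrite pblock_equivalence_partition ?inE // => a b d _ _ _.
exact: connect_equivalence.
Qed.

Lemma component_eq (G : sgraph) (K : {set G}) x :
  K \in components G -> x \in K -> pblock (components G) x = K.
Proof.
by case/and3P: (components_partition G) => _ tI _; apply: def_pblock.
Qed.

Section OddComponents.
Variables (G : sgraph) (c : seq G).
Local Notation H := (del_edges (cycle_edges c)).

Lemma odd_component_pblock x :
  (pblock (components H) x \in odd_components c) =
  odd #|[set y | connect (@adj H) x y & y \in c]|.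
Proof.
rewrite inE pblock_mem ?(cover_partition (components_partition H)) ?inE //=.
by congr odd; apply: eq_card => y; rewrite !inE (@mem_component H).
Qed.

Lemma odd_components_common_vertex :
    0 < size c -> #|odd_components c| <= 1 ->
  exists2 v, v \in c & forall K, K \in odd_components c -> v \in K.
Proof.
move=> c_gt0 few; have [odd0|[K oddK]] := set_0Vmem (odd_components c).
  case: (c) c_gt0 odd0 => // v s _ odd0; exists v; first exact: mem_head.
  by move=> K; rewrite odd0 inE.
have /set0Pn[v] : [set x in K | x \in c] != set0.
  by apply: contraTneq oddK; rewrite inE => ->; rewrite cards0 andbF.
rewrite inE => /andP[vK vc]; exists v => // K' oddK'.
by rewrite ((card_le1_eqP few) _ _ oddK oddK').
Qed.

(* The union of c and a T-join of G - E(c), for T the vertex set of c. *)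
Lemma parity_subgraph v0 :
    is_cycle c -> (forall K, K \in odd_components c -> v0 \in K) ->
  exists e : rel G, [/\ symmetric e, subrel e (@adj G), subrel (cycle_adj c) e &
    forall x, x != v0 -> odd (degree e x) = (x \in c)].
Proof.
case=> c_gt2 /andP[cc uc] v0_odd.
have even_T x : ~~ connect (@adj H) x v0 ->
    ~~ odd #|[set y | connect (@adj H) x y & y \in [set x in c]]|.
  apply: contra => odd_x; rewrite -mem_component; apply: v0_odd.
  rewrite odd_component_pblock; move: odd_x; congr (is_true (odd _)).
  by apply: eq_card => y; rewrite !inE.
have [J [Jsym JH Jodd]] := Tjoin_even_except (@adj_sym H) even_T.
have J_not_c x y : J x y -> cycle_adj c x y = false.
  by case/JH/andP=> _ /negPf; rewrite mem_cycle_edges.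
have cycle_adj_sym : symmetric (cycle_adj c).
  by move=> x y; rewrite -!mem_cycle_edges // setUC.
exists [rel x y | cycle_adj c x y (+) J x y].
split=> [x y|x y /=|x y /= cxy|x xv0].
- by rewrite /= cycle_adj_sym Jsym.
- case Jxy: (J x y); first by case/andP: (JH _ _ Jxy).
  rewrite addbF => /andP[xc /orP[]/eqP->]; first exact: next_cycle.
  by rewrite adj_sym; apply: prev_cycle.
- by rewrite cxy; apply/negP=> /J_not_c; rewrite cxy.
by rewrite odd_degree_addb (negPf (even_cycle_degree _ uc c_gt2)) Jodd // inE.
Qed.
End OddComponents.

Theorem two_odd_components (G : sgraph) (c : seq G) :
  unique_longest_cycle c -> 2 <= #|odd_components c|.
Proof.
move=> [[cyc_c max_c] uniq_c]; rewrite leqNgt; apply/negP; rewrite ltnS => few.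
have [c_gt2 /andP[_ uc]] := cyc_c.
have [v0 v0c v0_odd] := odd_components_common_vertex (ltnW (ltnW c_gt2)) few.
have [e [e_sym e_adj c_e e_odd]] := parity_subgraph cyc_c v0_odd.
have e_irr : irreflexive e.
  by move=> x; apply: contraFF (@adj_irr G x) => /e_adj.
have [i q rotE] := rot_to v0c.
have size_q : size c = (size q).+1 by rewrite -(size_rot i) rotE.
have uq : uniq (v0 :: q) by rewrite -rotE rot_uniq.
have mem_q : v0 :: q =i c by move=> x; rewrite -rotE mem_rot.
have adj_q : cycle_adj (v0 :: q) =2 cycle_adj c.
  by rewrite -rotE; apply: cycle_adj_rot.
have cyc_q : ucycle e (v0 :: q).
  rewrite /ucycle uq andbT; apply: cycle_from_next => // x xq.
  by apply: c_e; rewrite -adj_q /cycle_adj xq eqxx.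
have q_gt1 : 1 < size q by rewrite size_q in c_gt2.
have q_odd x : x != v0 -> odd (degree e x) = (x \in q).
  by move=> x_v0; rewrite e_odd // -mem_q inE (negPf x_v0).
have [q' [/andP[cq' uq'] last_q' sub_q' neq_q']] :=
  second_cycle e_sym e_irr q_gt1 cyc_q q_odd.
have size_q' : size c <= size (v0 :: q').
  apply: uniq_leq_size => // x; rewrite -mem_q !inE => /predU1P[->|/sub_q'->].
    by rewrite eqxx.
  exact: orbT.
have longest_q' : longest_cycle (v0 :: q').
  split=> [|d /max_c le_dc]; last exact: leq_trans le_dc size_q'.
  split; first exact: leq_trans size_q'.
  by rewrite /ucycle uq' andbT; apply: sub_cycle e_adj _ cq'.
have [adj_q' _] := eq_cycle_edges uq' uc.
case/eqP: neq_q'; apply: (cycle_adj_inj uq' uq q_gt1 last_q') => x y.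
by rewrite adj_q adj_q' // uniq_c.
Qed.

(** * Hexagons with pendants *)

Lemma card_set_in_seq (T : finType) (A : {set T}) (s : seq T) :
  uniq s -> #|[set x in A | x \in s]| = count [in A] s.
Proof.
move=> us; rewrite -size_filter -(card_uniqP (filter_uniq _ us)).
by apply: eq_card => x; rewrite !inE mem_filter.
Qed.

Lemma is_cycle_map (G H : sgraph) (f : G -> H) (c : seq G) :
    injective f -> {mono f : x y / adj x y} ->
  is_cycle (map f c) <-> is_cycle c.
Proof.
move=> f_inj f_adj; rewrite /is_cycle size_map /ucycle map_inj_uniq //.
by rewrite cycle_map (eq_cycle (e' := @adj G)).
Qed.

Lemma cycle_edges_map (G H : sgraph) (f : G -> H) (c : seq G) :
    injective f -> uniq c ->
  cycle_edges (map f c) = [set f @: A | A : {set G} in cycle_edges c].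
Proof.
move=> f_inj uc; apply/setP=> A; apply/imsetP/imsetP.
  case=> _ /mapP[x xs ->] ->; exists [set x; next c x]; first exact: imset_f.
  by rewrite imsetU !imset_set1 next_map.
case=> _ /imsetP[x xs ->] ->.
by exists (f x); rewrite ?map_f // imsetU !imset_set1 next_map.
Qed.

Lemma homo_connect (S T : finType) (e : rel S) (e' : rel T) (f : S -> T) :
    {homo f : x y / e x y >-> e' x y} ->
  {homo f : x y / connect e x y >-> connect e' x y}.
Proof.
move=> fe x y /connectP[p exp ->]; apply/connectP; exists (map f p).
  exact: homo_path exp.
by rewrite last_map.
Qed.

Lemma all_preimage (S T : Type) (f : S -> T) (P : pred T) (s : seq T) :
  (forall y, P y -> exists x, y = f x) -> all P s -> exists d, s = map f d.
Proof.
move=> Pf; elim: s => [|y s IHs] /=; first by exists [::].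
by case/andP=> /Pf[x ->] /IHs[d ->]; exists (x :: d).
Qed.

Section Bridge.
Variables (G H : sgraph) (g : G) (h : H).

Definition bridge_adj (x y : G + H) : bool :=
  match x, y with
  | inl x, inl y => adj x y
  | inr x, inr y => adj x y
  | inl x, inr y | inr y, inl x => (x == g) && (y == h)
  end.

Lemma bridge_adj_sym : symmetric bridge_adj.
Proof. by move=> [x|x] [y|y] //=; apply: adj_sym. Qed.

Lemma bridge_adj_irr : irreflexive bridge_adj.
Proof. by move=> [x|x] /=; apply: adj_irr. Qed.

Definition bridge : sgraph := SGraph bridge_adj_sym bridge_adj_irr.

Lemma bridge_degree (x : bridge) :
  degree (@adj bridge) x =
  match x with
  | inl x => degree (@adj G) x + (x == g)
  | inr x => degree (@adj H) x + (x == h)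
  end.
Proof.
rewrite /degree -sum1dep_card big_mkcond big_sumType -!big_mkcond /=.
case: x => x; rewrite !sum1dep_card; last rewrite [RHS]addnC; congr (_ + _).
  rewrite /=; case: (x == g); last by apply: eq_card0 => y; rewrite !inE.
  by apply: etrans (cards1 h); apply: eq_card => y; rewrite !inE.
rewrite /=; case: (x == h); last by apply: eq_card0 => y; rewrite !inE andbF.
by apply: etrans (cards1 g); apply: eq_card => y; rewrite !inE andbT.
Qed.

Lemma bridge_connected : connected G -> connected H -> connected bridge.
Proof.
move=> [G_gt0 Gc] [_ Hc]; split; first by rewrite card_sum addn_gt0 G_gt0.
pose e := @adj bridge.
have to_g x : connect e (inl x) (inl g) by apply: homo_connect (Gc x g).
have to_h x : connect e (inr x) (inr h) by apply: homo_connect (Hc x h).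
have gh : connect e (inl g) (inr h) by apply: connect1; rewrite /e /= !eqxx.
have all_to_h x : connect e x (inr h).
  by case: x => x; [apply: connect_trans (to_g x) gh | apply: to_h].
move=> x y; apply: connect_trans (all_to_h x) _.
by rewrite (sym_connect_sym (@adj_sym bridge)).
Qed.

(* To cross the bridge and come back, a cycle would use the same edge twice in
   a row. *)
Lemma bridge_cycle_side (c : seq bridge) :
  is_cycle c -> all (@is_inl G H) c || all (predC (@is_inl G H)) c.
Proof.
case=> c_gt2 /andP[cc uc]; apply/norP=> -[]; rewrite -!has_predC.
case/hasP=> x xc x_right /hasP[y yc /negbNE y_left].
have [[u|u] [u_in_c // _ u_exit]] := exists_exit uc yc xc y_left x_right.
have y_not_right : ~~ predC (@is_inl G H) y by rewrite /= negbK.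
have [[v|v] [v_in_c // _ v_exit]] := exists_exit uc xc yc x_right y_not_right.
have := next_cycle cc u_in_c; have := next_cycle cc v_in_c.
case Eu: (next c (inl u)) u_exit => [//|u'] _.
case Ev: (next c (inr v)) v_exit => [v'|//] _ /=.
move=> /andP[/eqP v'E /eqP vE] /andP[/eqP uE /eqP u'E].
by have := next_next_neq uc c_gt2 u_in_c; rewrite Eu u'E -vE Ev v'E uE eqxx.
Qed.

Lemma bridge_cycle (c : seq bridge) : is_cycle c ->
  (exists2 d : seq G, is_cycle d & c = map inl d) \/
  (exists2 d : seq H, is_cycle d & c = map inr d).
Proof.
move=> cyc; have /orP[] := bridge_cycle_side cyc.
  case/(all_preimage (f := inl)) => [[x|x] // _|d cE]; first by exists x.
  left; exists d => //; rewrite cE in cyc.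
  exact/(@is_cycle_map G bridge inl d inl_inj (fun _ _ => erefl)).
case/(all_preimage (f := inr)) => [[x|x] // _|d cE]; first by exists x.
right; exists d => //; rewrite cE in cyc.
exact/(@is_cycle_map H bridge inr d inr_inj (fun _ _ => erefl)).
Qed.
End Bridge.

Section EdgeGraph.
Variables (n : nat) (E : seq (nat * nat)).

Definition edge_rel : rel nat :=
  [rel i j | (i != j) && (((i, j) \in E) || ((j, i) \in E))].

Definition edge_graph_adj : rel 'I_n := relpre val edge_rel.

Lemma edge_graph_adj_sym : symmetric edge_graph_adj.
Proof. by move=> i j; rewrite /edge_graph_adj /edge_rel /= eq_sym orbC. Qed.

Lemma edge_graph_adj_irr : irreflexive edge_graph_adj.
Proof. by move=> i; rewrite /edge_graph_adj /edge_rel /= eqxx. Qed.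

Definition edge_graph : sgraph := SGraph edge_graph_adj_sym edge_graph_adj_irr.

Lemma edge_graph_degree (i : edge_graph) :
  degree (@adj edge_graph) i = count (edge_rel i) (iota 0 n).
Proof.
rewrite /degree -sum1dep_card -sum1_count -(big_mkord (edge_rel i) (fun=> 1)).
by rewrite /index_iota subn0.
Qed.

Lemma edge_graph_cycle_size (c : seq edge_graph) : is_cycle c -> size c <= n.
Proof.
by case=> _ /andP[_ uc]; rewrite -(card_uniqP uc) -[leqRHS]card_ord max_card.
Qed.
End EdgeGraph.

Lemma edge_graph_connected n (E : seq (nat * nat)) :
    all (fun i => has (edge_rel E i) (iota 0 i)) (iota 1 n) ->
  connected (edge_graph n.+1 E).
Proof.
move=> /allP has_smaller; split; first by rewrite card_ord.
pose e := @adj (edge_graph n.+1 E).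
have to0 i (lt_in : i < n.+1) : connect e (Ordinal lt_in) ord0.
  elim/ltn_ind: i lt_in => -[|i] IHi lt_in.
    by rewrite (_ : Ordinal lt_in = ord0); [apply: connect0 | apply: val_inj].
  have /hasP[j] : has (edge_rel E i.+1) (iota 0 i.+1).
    by apply: has_smaller; rewrite mem_iota.
  rewrite mem_iota => lt_ji e_ij.
  apply: connect_trans (IHi j lt_ji (ltn_trans lt_ji lt_in)).
  exact: connect1.
move=> [i lt_in] [j lt_jn]; apply: connect_trans (to0 i lt_in) _.
by rewrite (sym_connect_sym (@adj_sym (edge_graph n.+1 E))).
Qed.

Definition point : sgraph := edge_graph 1 [::].

(* The vertex 0 subdivides the edge 12. *)
Definition subdivided_K4 : sgraph :=
  edge_graph 5 [:: (0, 1); (0, 2); (1, 3); (1, 4); (2, 3); (2, 4); (3, 4)].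

Definition chorded_hexagon_edges : seq (nat * nat) :=
  [:: (0, 1); (1, 2); (2, 3); (3, 4); (4, 5); (5, 0); (1, 5); (2, 4)].

Definition chorded_hexagon : sgraph := edge_graph 6 chorded_hexagon_edges.

Lemma point_connected : connected point.
Proof. exact: edge_graph_connected. Qed.

Lemma subdivided_K4_connected : connected subdivided_K4.
Proof. exact: edge_graph_connected. Qed.

Lemma chorded_hexagon_connected : connected chorded_hexagon.
Proof. exact: edge_graph_connected. Qed.

Definition hexagon_vertex (i : nat) : chorded_hexagon := @inord 5 i.

Lemma val_hexagon_vertex i : i < 6 -> val (hexagon_vertex i) = i.
Proof. exact: inordK. Qed.

Lemma subdivided_K4_degree (x : subdivided_K4) :
  degree (@adj _) x + (x == ord0) = 3.
Proof. by rewrite edge_graph_degree; case: x => -[|[|[|[|[|]]]]]. Qed.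

Lemma chorded_hexagon_degree (x : chorded_hexagon) :
  degree (@adj _) x + (x == hexagon_vertex 0) + (x == hexagon_vertex 3) = 3.
Proof.
rewrite edge_graph_degree -!val_eqE !val_hexagon_vertex //.
by case: x => -[|[|[|[|[|[|]]]]]].
Qed.

(* A pendant is to be attached to another graph by a bridge at r. *)
Definition pendant (k : nat) (G : sgraph) (r : G) : Prop :=
  [/\ connected G, forall x, degree (@adj G) x + (x == r) = 3 &
      forall c : seq G, is_cycle c -> size c <= k].

Lemma subdivided_K4_pendant : pendant 5 (ord0 : subdivided_K4).
Proof.
split; [exact: subdivided_K4_connected | exact: subdivided_K4_degree |].
exact: edge_graph_cycle_size.
Qed.

Section JoinPendants.
Variables (k : nat) (G H : sgraph) (r : G) (s : H).
Hypotheses (rP : pendant k r) (sP : pendant k s).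

Definition join_pendants : sgraph :=
  @bridge (@bridge point G ord0 r) H (inl ord0) s.

Lemma join_pendantsP : pendant k (inl (inl ord0) : join_pendants).
Proof.
have [Gconn Gdeg Gcyc] := rP; have [Hconn Hdeg Hcyc] := sP; split.
- by do 2!apply: bridge_connected => //; apply: point_connected.
- move=> x; rewrite bridge_degree; case: x => [x|x]; last first.
    by rewrite -[RHS](Hdeg x) addn0.
  rewrite bridge_degree; case: x => [x|x]; last first.
    by rewrite -[RHS](Gdeg x) !addn0.
  by rewrite edge_graph_degree (ord1 x).
move=> c /bridge_cycle[[d d_cyc ->]|[b cyc_b ->]]; rewrite size_map; last first.
  exact: Hcyc.
case/bridge_cycle: d_cyc => -[b cyc_b ->]; rewrite size_map; last exact: Gcyc.
have [b_gt2 _] := cyc_b.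
by have := leq_trans b_gt2 (edge_graph_cycle_size cyc_b).
Qed.
End JoinPendants.

Fixpoint pendant_chain (n : nat) : {G : sgraph & G} :=
  if n is m.+1 then
    existT (fun G : sgraph => G)
      (join_pendants (ord0 : subdivided_K4) (tagged (pendant_chain m)))
      (inl (inl ord0))
  else existT (fun G : sgraph => G) subdivided_K4 ord0.

Lemma pendant_chainP n : pendant 5 (tagged (pendant_chain n)).
Proof.
elim: n => [|n IHn] /=; first exact: subdivided_K4_pendant.
exact: join_pendantsP subdivided_K4_pendant IHn.
Qed.

Lemma card_pendant_chain n : #|tag (pendant_chain n)| = 5 + 6 * n.
Proof.
elim: n => [|n IHn]; first by rewrite card_ord.
by rewrite !card_sum !card_ord IHn mulnS addnCA.
Qed.

Definition hexagon_cycle : seq chorded_hexagon := enum 'I_6.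

Lemma uniq_hexagon_cycle : uniq hexagon_cycle. Proof. exact: enum_uniq. Qed.

Lemma val_hexagon_cycle : map val hexagon_cycle = iota 0 6.
Proof. exact: val_enum_ord. Qed.

Lemma hexagon_cycleP : is_cycle hexagon_cycle.
Proof.
split; first by rewrite size_enum_ord.
rewrite /ucycle uniq_hexagon_cycle andbT.
have: cycle (edge_rel chorded_hexagon_edges) (map val hexagon_cycle).
  by rewrite val_hexagon_cycle.
by rewrite cycle_map.
Qed.

Lemma cycle_adj_hexagon_permutations :
  all (fun w => cycle (edge_rel chorded_hexagon_edges) w ==>
         all2rel (fun i j => cycle_adj w i j == cycle_adj (iota 0 6) i j)
           (iota 0 6))
    (permutations (iota 0 6)).
Proof. by vm_compute. Qed.

Lemma cycle_adj_hexagon (d : seq chorded_hexagon) :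
  is_cycle d -> size d = 6 -> cycle_adj d =2 cycle_adj hexagon_cycle.
Proof.
case=> _ /andP[cd ud] size_d x y.
have perm_d : perm_eq (map val d) (iota 0 6).
  rewrite -val_hexagon_cycle perm_map // uniq_perm ?uniq_hexagon_cycle //.
  have [z _||//] := @uniq_min_size _ d (enum 'I_6) ud; first exact: mem_enum.
  by rewrite size_enum_ord size_d.
have := allP cycle_adj_hexagon_permutations (map val d).
rewrite mem_permutations => /(_ perm_d)/implyP; rewrite cycle_map => /(_ cd).
have in_iota (z : 'I_6) : val z \in iota 0 6 by rewrite mem_iota ltn_ord.
move/allrelP/(_ (val x) (val y) (in_iota x) (in_iota y))/eqP.
by rewrite -val_hexagon_cycle !(cycle_adj_map _ _ val_inj) ?uniq_hexagon_cycle.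
Qed.

Lemma same_component_chord (G : sgraph) (c : seq G) (K : {set G}) x y :
    uniq c -> K \in odd_components c -> adj x y -> ~~ cycle_adj c x y ->
  (x \in K) = (y \in K).
Proof.
move=> uc /setIdP[/imsetP[z _ ->] _] xy not_cxy; rewrite !inE.
apply: (same_connect_r (sym_connect_sym (@adj_sym _))); apply: connect1.
by apply/andP; split; rewrite ?mem_cycle_edges.
Qed.

Section CappedHexagon.
Variables (G H : sgraph) (r : G) (s : H).
Hypotheses (rP : pendant 5 r) (sP : pendant 5 s).

Definition capped_hexagon : sgraph :=
  @bridge (@bridge chorded_hexagon G (hexagon_vertex 0) r) H
    (inl (hexagon_vertex 3)) s.

Definition hexagon_emb (x : chorded_hexagon) : capped_hexagon := inl (inl x).

Definition capped_cycle : seq capped_hexagon := map hexagon_emb hexagon_cycle.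

Lemma hexagon_emb_inj : injective hexagon_emb.
Proof. by move=> x y []. Qed.

Lemma capped_hexagon_connected : connected capped_hexagon.
Proof.
have [Gconn _ _] := rP; have [Hconn _ _] := sP.
by do 2!apply: bridge_connected => //; apply: chorded_hexagon_connected.
Qed.

Lemma capped_hexagon_regular : regular 3 capped_hexagon.
Proof.
have [_ Gdeg _] := rP; have [_ Hdeg _] := sP.
move=> x; rewrite -/(degree _ x) bridge_degree.
case: x => [x|x]; last exact: Hdeg.
rewrite bridge_degree; case: x => x; first exact: chorded_hexagon_degree.
by rewrite addn0; apply: Gdeg.
Qed.

Lemma capped_hexagon_cycle (c : seq capped_hexagon) : is_cycle c ->
  size c <= 5 \/ exists2 d, is_cycle d & c = map hexagon_emb d.
Proof.
have [_ _ Gcyc] := rP; have [_ _ Hcyc] := sP.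
case/bridge_cycle=> [[b /bridge_cycle b_cases ->]|[d cyc_d ->]]; last first.
  by left; rewrite size_map; apply: Hcyc.
case: b_cases => -[d cyc_d ->]; last by left; rewrite !size_map; apply: Gcyc.
by right; exists d; rewrite -?map_comp.
Qed.

Lemma capped_cycle_unique_longest : unique_longest_cycle capped_cycle.
Proof.
have size_capped : size capped_cycle = 6 by rewrite size_map size_enum_ord.
have cyc_capped : is_cycle capped_cycle.
  exact/(is_cycle_map _ hexagon_emb_inj (fun _ _ => erefl))/hexagon_cycleP.
split.
  split=> // d; rewrite size_capped.
  case/capped_hexagon_cycle=> [/leqW//|[b cyc_b ->]].
  by rewrite size_map edge_graph_cycle_size.
move=> d [/capped_hexagon_cycle d_cases /(_ _ cyc_capped)]; rewrite size_capped.
case: d_cases => [d_le5 /leq_trans/(_ d_le5)//|[b cyc_b ->]].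
rewrite size_map => b_ge6; have [_ /andP[_ ub]] := cyc_b.
have size_b : size b = 6.
  by apply/eqP; rewrite eqn_leq b_ge6 edge_graph_cycle_size.
rewrite !cycle_edges_map ?uniq_hexagon_cycle //; try exact: hexagon_emb_inj.
have [_ -> //] := eq_cycle_edges ub uniq_hexagon_cycle.
exact: cycle_adj_hexagon.
Qed.

Let corner i := hexagon_emb (hexagon_vertex i).

Lemma uniq_capped_cycle : uniq capped_cycle.
Proof. by rewrite (map_inj_uniq hexagon_emb_inj) uniq_hexagon_cycle. Qed.

Lemma odd_component_hexagon_chord K i j :
    K \in odd_components capped_cycle -> i < 6 -> j < 6 ->
    edge_rel chorded_hexagon_edges i j -> ~~ cycle_adj (iota 0 6) i j ->
  (corner i \in K) = (corner j \in K).
Proof.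
move=> oddK lt_i lt_j edge_ij not_cij.
apply: same_component_chord uniq_capped_cycle oddK _ _.
  by rewrite -[adj _ _]/(edge_rel _ (val _) (val _)) !val_hexagon_vertex.
rewrite (cycle_adj_map _ _ hexagon_emb_inj) ?uniq_hexagon_cycle //.
rewrite -(cycle_adj_map _ _ val_inj) ?uniq_hexagon_cycle // val_hexagon_cycle.
by rewrite !val_hexagon_vertex.
Qed.

Lemma odd_component_hexagon_cap K :
  K \in odd_components capped_cycle -> (corner 0 \in K) || (corner 3 \in K).
Proof.
move=> oddK; have: odd (count [pred i | corner i \in K] (iota 0 6)).
  rewrite -val_hexagon_cycle count_map; have /setIdP[_] := oddK.
  rewrite card_set_in_seq ?uniq_capped_cycle // count_map.
  congr (is_true (odd _)); apply: eq_count => x /=.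
  by rewrite /corner /hexagon_vertex inord_val.
have corner15 : (corner 1 \in K) = (corner 5 \in K).
  exact: odd_component_hexagon_chord.
have corner24 : (corner 2 \in K) = (corner 4 \in K).
  exact: odd_component_hexagon_chord.
rewrite /= corner15 corner24.
case: (corner 0 \in K) (corner 3 \in K) => [] [] //.
by case: (corner 5 \in K) (corner 4 \in K) => [] [].
Qed.

Lemma card_odd_components_capped_cycle : #|odd_components capped_cycle| = 2.
Proof.
apply/eqP; rewrite eqn_leq two_odd_components ?andbT; last first.
  exact: capped_cycle_unique_longest.
pose comp x := pblock (components (del_edges (cycle_edges capped_cycle))) x.
apply: leq_trans (_ : #|[set comp (corner 0); comp (corner 3)]| <= 2).
  apply/subset_leq_card/subsetP=> K oddK; have /setIdP[K_comp _] := oddK.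
  by have /orP[corner_K|corner_K] := odd_component_hexagon_cap oddK;
    rewrite -(component_eq K_comp corner_K) !inE eqxx ?orbT.
by rewrite cards2 ltnS leq_b1.
Qed.
End CappedHexagon.

Theorem theorem5 :
  (forall (G : sgraph) (c : seq G),
     connected G -> regular 3 G -> unique_longest_cycle c ->
     2 <= #|odd_components c|)
  /\
  (exists F : nat -> sgraph,
     (forall m n : nat, m <> n -> ~ graph_iso (F m) (F n)) /\
     (forall n : nat,
        connected (F n) /\ regular 3 (F n) /\
        exists c : seq (F n),
          unique_longest_cycle c /\ #|odd_components c| = 2)).
Proof.
split=> [G c _ _|]; first exact: two_odd_components.
pose G0 := subdivided_K4; pose P n := pendant_chain n.
exists (fun n => capped_hexagon (ord0 : G0) (tagged (P n))).
split=> [m n neq_mn|n].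
  case=> f [/bij_eq_card + _]; rewrite !card_sum !card_pendant_chain.
  by move/addnI/addnI/eqP; rewrite eqn_pmul2l // => /eqP.
have G0_pendant := subdivided_K4_pendant; have P_pendant := pendant_chainP n.
split; first exact: capped_hexagon_connected.
split; first exact: capped_hexagon_regular.
exists (capped_cycle (ord0 : G0) (tagged (P n))); split.
  exact: capped_cycle_unique_longest.
exact: card_odd_components_capped_cycle.
Qed.
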